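(* Let $\mathbb X,\mathbb Y$ be finite-dimensional Hilbert spaces, $\lambda>0$, $b\in\mathbb Y$. Let $f:\mathbb X\to\mathbb R\cup\{+\infty\}$ be proper, closed and convex, let $A:\mathbb X\to\mathbb Y$ be a surjective linear operator, and assume $\{x\in\operatorname{dom} f:Ax=b\}\neq\emptyset$. For given $z\in\mathbb X$, the following statements are equivalent: (i) the mapping $T_z$, defined on $\mathcal U:=A^*\mathbb Y$ by $T_z(u)=\operatorname{Prox}_{\lambda f}(z+u)$, is globally strongly monotone; (ii) the dual problem $\min_{y\in\mathbb Y}\Phi_z(y)$ is globally strongly convex, i.e. $\Phi_z$ is strongly convex on $\mathbb Y$.
   Context: $\operatorname{Prox}_h(t)=\arg\min_x\{h(x)+\tfrac12\|x-t\|^2\}$, which is single-valued for $h=\lambda f$ here. $A^*\mathbb Y$ is the range of the adjoint of $A$. The dual objective is $\Phi_z(y)=-\inf_{x\in\mathbb X}\{\lambda f(x)+\tfrac12\|x-z\|^2+\langle y,b-Ax\rangle\}$, associated with the primal problem $\min_x\{\lambda f(x)+\tfrac12\|x-z\|^2:Ax=b\}$. $T_z$ is globally strongly monotone if there is $c>0$ such that $\langle T_z(u_1)-T_z(u_2),u_1-u_2\rangle\ge c\|u_1-u_2\|^2$ for all $u_1,u_2\in\mathcal U$. *)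

(* Defs.v *)
From HB Require Import structures.
From mathcomp Require Import all_boot all_order all_algebra.
From mathcomp Require Import all_classical all_reals all_analysis.

Set Implicit Arguments.
Unset Strict Implicit.
Unset Printing Implicit Defensive.

Import Order.TTheory GRing.Theory Num.Theory.
Import numFieldNormedType.Exports.

Local Open Scope classical_set_scope.
Local Open Scope ring_scope.

(* Positive definiteness of the inner product comes from [innerE] and the
   definiteness of the norm; completeness is automatic in finite dimension. *)
HB.mixin Record NormedVector_hasInner (R : realType) X
    of NormedModule R X & Vector R X := {
  inner : X -> X -> R ;
  innerC : forall x y, inner x y = inner y x ;
  inner_linearl : forall (a : R) (x y w : X),
    inner (a *: x + y) w = a * inner x w + inner y w ;
  innerE : forall x : X, inner x x = `|x| ^+ 2
}.

#[short(type="finHilbertType")]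
HB.structure Definition FinHilbert (R : realType) :=
  {X of NormedModule R X & Vector R X & NormedVector_hasInner R X}.

Notation "⟨ x , y ⟩" := (inner x y)
  (at level 0, x at level 99, y at level 99, format "⟨ x ,  y ⟩") : ring_scope.

Section InnerTheory.
Context {R : realType} {X : finHilbertType R}.
Implicit Types x y w : X.

Lemma innerDl x y w : ⟨x + y, w⟩ = ⟨x, w⟩ + ⟨y, w⟩.
Proof. by rewrite -[x]scale1r inner_linearl mul1r scale1r. Qed.

Lemma inner0l w : ⟨(0 : X), w⟩ = 0.
Proof.
by have /eqP := innerDl 0 0 w; rewrite addr0 -subr_eq0 opprD addrA subrr
  sub0r oppr_eq0 => /eqP.
Qed.

Lemma innerZl (a : R) x w : ⟨a *: x, w⟩ = a * ⟨x, w⟩.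
Proof. by rewrite -[a *: x]addr0 inner_linearl inner0l addr0. Qed.

Lemma innerBl x y w : ⟨x - y, w⟩ = ⟨x, w⟩ - ⟨y, w⟩.
Proof. by rewrite innerDl -scaleN1r innerZl mulN1r. Qed.

Lemma inner_suml (I : finType) (F : I -> X) w :
  ⟨\sum_i F i, w⟩ = \sum_i ⟨F i, w⟩.
Proof.
by apply: (big_morph (inner^~ w)) => [x y|]; [exact: innerDl|exact: inner0l].
Qed.

Lemma inner_eq0 x : (⟨x, x⟩ == 0) = (x == 0).
Proof. by rewrite innerE sqrf_eq0 normr_eq0. Qed.

Lemma inner_inj x y : (forall w, ⟨x, w⟩ = ⟨y, w⟩) -> x = y.
Proof.
by move=> xy; apply/eqP; rewrite -subr_eq0 -inner_eq0 innerBl xy subrr.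
Qed.

Lemma riesz (phi : {scalar X}) : exists x, forall w, ⟨x, w⟩ = phi w.
Proof.
pose e := vbasis {:X}.
pose G := fun x => \row_(i < \dim {:X}) ⟨x, e`_i⟩ : 'rV[R]_(\dim {:X}).
have Glin : linear G.
  by move=> a x y; apply/rowP => i; rewrite !mxE inner_linearl.
pose GL := linfun (HB.pack_for {linear X -> 'rV[R]_(\dim {:X})} G
  (GRing.isLinear.Build _ _ _ _ G Glin)).
have GLE x : GL x = G x by rewrite lfunE.
have decomp w : w = \sum_(i < \dim {:X}) coord e i w *: e`_i.
  by apply: coord_vbasis; exact: memvf.
have kerG : lker GL == 0%VS.
  apply/lker0P => x y; rewrite !GLE => /rowP Gxy.
  apply: inner_inj => w; rewrite (decomp w) ![⟨_, \sum_i _⟩]innerC !inner_suml.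
  apply: eq_bigr => i _; rewrite !innerZl; congr (_ * _).
  by have := Gxy i; rewrite !mxE [⟨e`_i, x⟩]innerC [⟨e`_i, y⟩]innerC.
have limG : limg GL = fullv.
  apply/eqP; rewrite eqEdim subvf limg_dim_eq; first by
    rewrite dimvf /dim /= mul1n.
  by rewrite (eqP kerG) capv0.
have : (\row_i phi e`_i : 'rV[R]_(\dim {:X})) \in limg GL.
  by rewrite limG memvf.
move=> /memv_imgP[x _ /rowP]; rewrite GLE => Gx; exists x => w.
rewrite (decomp w) linear_sum innerC inner_suml; apply: eq_bigr => i _.
by rewrite innerZl linearZ /= [⟨e`_i, x⟩]innerC; have := Gx i; rewrite !mxE => ->.
Qed.

End InnerTheory.

Section Adjoint.
Context {R : realType} {X Y : finHilbertType R}.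

Definition adjoint (A : {linear X -> Y}) (y : Y) : X :=
  xget 0 [set x | forall w, ⟨x, w⟩ = ⟨y, A w⟩].

Lemma adjointP (A : {linear X -> Y}) (y : Y) (w : X) :
  ⟨adjoint A y, w⟩ = ⟨y, A w⟩.
Proof.
rewrite /adjoint; case: xgetP => [x -> //|/= nx].
have phil : scalar (fun x => ⟨y, A x⟩).
  by move=> a u v; rewrite linearP !(innerC y) inner_linearl.
have [x xP] := riesz (HB.pack_for {scalar X} (fun x => ⟨y, A x⟩)
  (GRing.isLinear.Build _ _ _ _ (fun x => ⟨y, A x⟩) phil)).
by have := nx x xP.
Qed.

End Adjoint.

Section ConvexAnalysis.
Context {R : realType} {V : finHilbertType R}.
Implicit Types (g h : V -> \bar R) (T : V -> V) (U : set V).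
Local Open Scope ereal_scope.

Definition edom g : set V := [set x | g x < +oo].

Definition proper_fun g := (forall x, -oo < g x) /\ edom g !=set0.

Definition epigraph g : set (V * R) := [set p | g p.1 <= p.2%:E].

Definition closed_fun g := closed (epigraph g).

(* Only used for functions avoiding -oo, so that no oo - oo occurs; the same
   remark applies to [strongly_convex]. *)
Definition convex_fun g := forall (x y : V) (t : R), (0 < t < 1)%R ->
  g (t *: x + (1 - t) *: y)%R <= t%:E * g x + (1 - t)%:E * g y.

Definition strongly_convex g := exists2 mu : R, (0 < mu)%R &
  forall (x y : V) (t : R), (0 < t < 1)%R ->
    g (t *: x + (1 - t) *: y)%R <=
      t%:E * g x + (1 - t)%:E * g y
      - (mu / 2 * t * (1 - t) * `|x - y| ^+ 2)%:E.

Definition strongly_monotone_on U T := exists2 c : R, (0 < c)%R &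
  forall u1 u2, U u1 -> U u2 ->
    (⟨T u1 - T u2, u1 - u2⟩ >= c * `|u1 - u2| ^+ 2)%R.

Definition argmin g : set V := [set x | forall y, g x <= g y].

(* The point of the argmin set, which is a singleton when h is proper, closed
   and convex; 0 if that set is empty. *)
Definition Prox h (t : V) : V :=
  xget 0%R (argmin (fun x => h x + (2^-1 * `|x - t| ^+ 2)%:E)).

End ConvexAnalysis.

Section ProximalDual.
Context {R : realType} {X Y : finHilbertType R}.
Variables (A : {linear X -> Y}) (b : Y) (f : X -> \bar R) (lambda : R) (z : X).
Local Open Scope ereal_scope.

Definition prox_shift (u : X) : X :=
  Prox (fun x => lambda%:E * f x) (z + u)%R.

Definition dual_obj (y : Y) : \bar R :=
  - ereal_inf [set lambda%:E * f x + (2^-1 * `|x - z| ^+ 2)%:E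
                   + ⟨y, (b - A x)%R⟩%:E | x in [set: X]].

End ProximalDual.

(* Main.v *)
Require Import Defs.
From HB Require Import structures.
From mathcomp Require Import all_boot all_order all_algebra.
From mathcomp Require Import all_classical all_reals all_analysis.
From mathcomp Require Import ring lra.

Import Order.TTheory GRing.Theory Num.Theory.
Import numFieldNormedType.Exports.

Local Open Scope classical_set_scope.
Local Open Scope ring_scope.

(** Write [u = A^*y]. Completing the square turns the Lagrangian
    [lambda f(x) + |x - z|^2/2 + <y, b - Ax>] into the proximal objective at
    [z + u] plus a constant in [x], so it is minimised at [T_z(A^*y)]. The
    minimum exists ([prox_objective_argmin]), hence [Phi_z] is real valued; as
    [- Phi_z] is an infimum of functions affine in [y], evaluating the
    Lagrangian of [y'] at the minimiser for [y] shows that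
    [s(y) = A T_z(A^*y) - b] is a subgradient of [Phi_z] at [y]
    ([dual_subgradient]).

    For a finite function with a selection [s] of subgradients, strong convexity
    of the function and strong monotonicity of [s] are equivalent
    ([strongly_convex_of_monotone], [strongly_monotone_of_convex]). Only the
    existence of a positive constant matters, so two-point arguments suffice
    and no integration along segments occurs.

    Finally, [<s(y1) - s(y2), y1 - y2>] equals
    [<T_z(u1) - T_z(u2), u1 - u2>] for [ui = A^*yi], and since [A] is onto,
    [|A^*y|] and [|y|] bound each other up to constants; so strong monotonicity
    of [s] on the dual space is that of [T_z] on the range of [A^*]
    ([monotone_transfer]).

    The analytic input is the existence of the proximal point. Closed balls are
    compact because each is covered by the image of a box of coordinates; a
    function with closed sublevel sets attains its minimum there; and convexity
    makes [f] decrease at most linearly at infinity, so the quadratic term wins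
    outside a large ball. *)

(** * Inner products and linear maps in finite dimension *)

Section InnerAlgebra.
Context {R : realType} {V : finHilbertType R}.
Implicit Types x y w : V.

Lemma innerDr w x y : ⟨w, x + y⟩ = ⟨w, x⟩ + ⟨w, y⟩.
Proof. by rewrite innerC innerDl !(innerC w). Qed.

Lemma innerBr w x y : ⟨w, x - y⟩ = ⟨w, x⟩ - ⟨w, y⟩.
Proof. by rewrite innerC innerBl !(innerC w). Qed.

Lemma innerZr w (a : R) x : ⟨w, a *: x⟩ = a * ⟨w, x⟩.
Proof. by rewrite innerC innerZl innerC. Qed.

Lemma cauchy_schwarz x y : `|⟨x, y⟩| <= `|x| * `|y|.
Proof.
have le_norm (u v : V) : ⟨u, v⟩ <= `|u| * `|v|.
  have [->|u0] := eqVneq u 0; first by rewrite inner0l normr0 mul0r.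
  have [->|v0] := eqVneq v 0; first by rewrite innerC inner0l normr0 mulr0.
  have := sqr_ge0 `| (`|v| *: u - `|u| *: v) |.
  rewrite -innerE innerBl !innerBr !innerZl !innerZr !innerE (innerC v u).
  have nu : 0 < `|u| by rewrite normr_gt0.
  have nv : 0 < `|v| by rewrite normr_gt0.
  have nuv := mulr_gt0 nu nv => sq_ge0.
  rewrite -(ler_pM2l nuv); nra.
rewrite ler_norml le_norm andbT lerNl.
by have := le_norm (- x) y; rewrite -scaleN1r innerZl mulN1r scaleN1r normrN.
Qed.

End InnerAlgebra.

Section FiniteDimension.
Context {R : realType} {V : finHilbertType R}.
Let n := \dim {:V}.

(** A coordinate is a linear form, hence an inner product with a fixed vector,
    and Cauchy-Schwarz bounds it. *)
Lemma coords_bounded : exists M : 'I_n -> R,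
  forall i, 0 <= M i /\ forall x, `|coord (vbasis {:V}) i x| <= M i * `|x|.
Proof.
suff /choice[M MP] (i : 'I_n) : exists M : R, 0 <= M /\
    forall x, `|coord (vbasis {:V}) i x| <= M * `|x| by exists M.
have [r rE] := riesz (coord (vbasis {:V}) i).
by exists `|r|; split=> // x; rewrite -rE cauchy_schwarz.
Qed.

Lemma lincomb_bounded {W : normedModType R} (c : 'I_n -> W) :
  exists2 M : R, 0 < M &
    forall x, `|\sum_i coord (vbasis {:V}) i x *: c i| <= M * `|x|.
Proof.
have [M MP] := coords_bounded.
have sum_ge0 : 0 <= \sum_i M i * `|c i|.
  by apply: sumr_ge0 => i _; rewrite mulr_ge0//; case: (MP i).
exists (1 + \sum_i M i * `|c i|); first by rewrite ltr_pwDl.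
move=> x; rewrite mulrDl mul1r -[leLHS]add0r lerD//.
apply: le_trans (ler_norm_sum _ _ _) _.
rewrite mulr_suml; apply: ler_sum => i _.
by rewrite normrZ mulrAC ler_wpM2r//; case: (MP i).
Qed.

Lemma linear_bounded {W : normedModType R} (L : {linear V -> W}) :
  exists2 M : R, 0 < M & forall x, `|L x| <= M * `|x|.
Proof.
have [M M0 MP] := lincomb_bounded (fun i => L (vbasis {:V})`_i).
exists M => // x; have xE := coord_vbasis (memvf x).
rewrite [in L x]xE linear_sum; under eq_bigr do rewrite linearZ.
exact: MP.
Qed.

(** The ball is closed and lies in the image of a compact box under the
    continuous map sending coordinates to vectors. *)
Lemma compact_cball (x0 : V) (r : R) : compact [set x | `|x0 - x| <= r].
Proof.
pose L (v : 'rV[R]_n) : V := \sum_(i < n) v ord0 i *: (vbasis {:V})`_i.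
have Lcont : continuous L.
  apply: continuous_big; first exact: add_continuous.
  move=> i _ v; apply: cvgZr_tmp; first exact: nbhs_filter.
  exact: coord_continuous.
have [M MP] := coords_bounded.
pose a i := M i * (`|x0| + r).
have boxK : compact
    [set v : 'rV[R]_n | forall i, [set` `[- a i, a i]] (v ord0 i)].
  apply: (@rV_compact R n (fun i => [set` `[- a i, a i]])) => i.
  exact: segment_compact.
have LK := continuous_compact (continuous_subspaceT Lcont) boxK.
apply: subclosed_compact LK _; first exact: closed_closed_ball_.
move=> x /= xr; exists (\row_i coord (vbasis {:V}) i x); last first.
  rewrite [RHS](coord_vbasis (memvf x)); apply: eq_bigr => i _.
  by rewrite mxE.
move=> i /=; rewrite mxE in_itv /= -ler_norml.
have [Mi0 MiP] := MP i; apply: le_trans (MiP x) _; rewrite ler_wpM2l//.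
have -> : x = x0 - (x0 - x) by rewrite subKr.
by rewrite (le_trans (ler_normB _ _))// lerD2l.
Qed.

End FiniteDimension.

Section Adjoint.
Context {R : realType} {X Y : finHilbertType R}.
Variable A : {linear X -> Y}.

Lemma adjointB y1 y2 : adjoint A y1 - adjoint A y2 = adjoint A (y1 - y2).
Proof. by apply: inner_inj => w; rewrite innerBl !adjointP innerBl. Qed.

(** From [|A^*y|^2 = <y, A A^*y>] and the boundedness of [A]. *)
Lemma adjoint_bounded :
  exists2 M : R, 0 < M & forall y, `|adjoint A y| <= M * `|y|.
Proof.
have [M M0 AM] := linear_bounded A; exists M => // y.
have [->|a0] := eqVneq (adjoint A y) 0.
  by rewrite normr0 mulr_ge0// ltW.
have na : 0 < `|adjoint A y| by rewrite normr_gt0.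
rewrite -(ler_pM2r na) -expr2 -innerE adjointP.
apply: le_trans (ler_norm _) _; apply: le_trans (cauchy_schwarz _ _) _.
by rewrite -mulrA mulrCA ler_wpM2l.
Qed.

(** If [x] is a preimage of [y] under [A] depending linearly on [y], then
    [|y|^2 = <y, Ax> = <A^*y, x>] is at most [|A^*y| |x|], and [|x|] is bounded
    by a multiple of [|y|]. *)
Lemma adjoint_bounded_below : set_surj [set: X] [set: Y] A ->
  exists2 M : R, 0 < M & forall y, `|y| <= M * `|adjoint A y|.
Proof.
move=> surjA.
have /choice[c cE] (i : 'I_(\dim {:Y})) : exists x, A x = (vbasis {:Y})`_i.
  by have [//|x _ <-] := surjA (vbasis {:Y})`_i; exists x.
have [M M0 cM] := lincomb_bounded c; exists M => // y.
have [->|y0] := eqVneq y 0; first by rewrite normr0 mulr_ge0// ltW.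
have ny : 0 < `|y| by rewrite normr_gt0.
pose x := \sum_i coord (vbasis {:Y}) i y *: c i.
have Ax : A x = y.
  rewrite linear_sum [RHS](coord_vbasis (memvf y)).
  by apply: eq_bigr => i _; rewrite linearZ/= cE.
rewrite -(ler_pM2r ny) -expr2 -innerE -{2}Ax -adjointP.
apply: le_trans (ler_norm _) _; apply: le_trans (cauchy_schwarz _ _) _.
by rewrite mulrAC mulrC ler_wpM2r// cM.
Qed.

End Adjoint.

(** * Existence of proximal points *)

(** The sublevel sets through points of [K] are nested, so they generate a
    filter; its cluster points lie in all of them. *)
Lemma lsc_min_compact {R : realType} {V : topologicalType}
    (K : set V) (F : V -> \bar R) :
  compact K -> K !=set0 -> (forall x, -oo < F x)%E ->
  (forall a : R, closed [set x | (F x <= a%:E)%E]) ->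
  exists2 p, K p & forall x, K x -> (F p <= F x)%E.
Proof.
move=> cK [x0 Kx0] F_gt clF.
pose B x := K `&` [set y | (F y <= F x)%E].
have FB : ProperFilter (filter_from K B).
  apply: filter_from_proper; last by move=> x Kx; exists x; split => /=.
  apply: filter_from_filter; first by exists x0.
  move=> x y Kx Ky; have [Fxy|/ltW Fyx] := leP (F x) (F y).
    exists x => // w [Kw wx]; split; split => //=; exact: le_trans Fxy.
  exists y => // w [Kw wx]; split; split => //=; exact: le_trans Fyx.
have [|p [Kp clp]] := cK _ FB.
  by exists x0 => // y [].
exists p => // x Kx.
case Fx : (F x) => [a| |]; [|by rewrite leey|by have := F_gt x; rewrite Fx].
apply: (clF a).
move: clp; rewrite clusterE => /(_ (B x)) pB.
apply: closureS (pB _); first by move=> y [_]; rewrite /= Fx.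
by exists x.
Qed.

Section Prox.
Context {R : realType} {V : finHilbertType R}.
Variable f : V -> \bar R.
Hypotheses (f_proper : proper_fun f) (f_closed : closed_fun f).

Lemma closed_sublevel_add (lambda : R) (q : V -> R) (a : R) :
  0 < lambda -> continuous q ->
  closed [set x | (lambda%:E * f x + (q x)%:E <= a%:E)%E].
Proof.
move=> l0 qc.
rewrite (_ : mkset _ = (fun x => (x, lambda^-1 * (a - q x))) @^-1` epigraph f).
  apply: preimage_closed f_closed => x _ /=.
  have c2 : lambda^-1 * (a - q y) @[y --> x] --> lambda^-1 * (a - q x).
    by apply: cvgMl_tmp; apply: cvgB; [exact: cvg_cst|exact: qc].
  have c1 : y @[y --> x] --> x by exact: cvg_id.
  exact: (cvg_pair c1 c2).
apply/funext => x; apply/propext; rewrite /= /epigraph /=.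
have [fgt _] := f_proper; have := fgt x; case: (f x) => [r| |]// _.
  by rewrite -EFinM -EFinD !lee_fin ler_pdivlMl// lerBrDr.
by rewrite gt0_muley ?lte_fin.
Qed.

Hypothesis f_convex : convex_fun f.

(** With [m] the minimum of [f] on the unit ball around [x0], convexity on the
    segment from [x0] to a point at distance [d > 1] gives
    [f x >= f x0 - d (f x0 - m)]; inside the ball [f x >= m]. The factor
    [1 + d] covers both cases. *)
Lemma convex_linear_lbound (x0 : V) (r0 : R) : f x0 = r0%:E ->
  exists2 K : R, 0 <= K &
    forall x, ((r0 - K * (1 + `|x0 - x|))%:E <= f x)%E.
Proof.
move=> fx0; have [fgt _] := f_proper.
have [||||p pB pmin] := lsc_min_compact [set x | `|x0 - x| <= 1] f.
- exact: compact_cball.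
- by exists x0; rewrite /= subrr normr0.
- exact: fgt.
- move=> a.
  have := @closed_sublevel_add 1 (cst 0) a ltr01 (@cst_continuous _ _ 0).
  by under eq_set do rewrite mul1e adde0.
have := pmin x0; rewrite /= subrr normr0 fx0 => /(_ ler01).
move: (fgt p) pmin; case: (f p) => [m| |]// _ pmin; rewrite lee_fin => mr0.
exists (r0 - m); rewrite ?subr_ge0// => x.
have [x1|x1] := leP `|x0 - x| 1.
  apply: le_trans (pmin x x1); rewrite lee_fin.
  have := normr_ge0 (x0 - x); nra.
set d := `|x0 - x| in x1 *; have d0 : 0 < d by rewrite (lt_trans _ x1).
case fx : (f x) => [r| |]; [|by rewrite leey|by have := fgt x; rewrite fx].
(* t is the weight that puts the point t x + (1 - t) x0 on the unit sphere. *)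
pose t := d^-1; have t01 : 0 < t < 1 by rewrite invr_gt0 d0 invf_lt1.
have := f_convex x x0 t t01; rewrite fx fx0 => cvx.
have /pmin : `|x0 - (t *: x + (1 - t) *: x0)| <= 1.
  rewrite (_ : _ - _ = t *: (x0 - x)); last first.
    by rewrite scalerBl scale1r scalerBr opprD addrCA subKr addrC.
  by rewrite normrZ gtr0_norm ?invr_gt0// mulVf ?gt_eqF.
move=> /le_trans /(_ cvx); rewrite -!EFinM -EFinD !lee_fin => mle.
have td : t * d = 1 by rewrite mulVf ?gt_eqF.
have : d * m <= d * (t * r + (1 - t) * r0) by rewrite ler_pM2l.
have -> : d * (t * r + (1 - t) * r0) = r + (d - 1) * r0.
  by rewrite mulrDr !mulrA mulrBr mulr1 (mulrC d t) td mul1r.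
nra.
Qed.

Lemma prox_objective_argmin (lambda : R) (w : V) : 0 < lambda ->
  argmin (fun x => lambda%:E * f x + (2^-1 * `|x - w| ^+ 2)%:E)%E !=set0.
Proof.
move=> l0; have [fgt [x0 fx0]] := f_proper.
move: fx0 (fgt x0); rewrite /edom /=.
case fx0 : (f x0) => [r0| |]// _ _.
have [K K0 fK] := convex_linear_lbound x0 r0 fx0.
set F := (fun x => _)%E.
(* At distance d >= r from x0 the quadratic term grows by at least
   (d - D)^2/2 - D^2/2 = d (d - 2 D)/2 >= 2 lambda K d, which outweighs the
   loss lambda K (1 + d) in lambda f because d >= 1. *)
pose D := `|x0 - w|; pose r := 1 + 2 * D + 4 * (lambda * K).
have D0 : 0 <= D by exact: normr_ge0.
have lK0 : 0 <= lambda * K by rewrite mulr_ge0// ltW.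
have Fgt x : (-oo < F x)%E.
  rewrite /F; have := fgt x; case: (f x) => [s| |]// _.
  - by rewrite -EFinM -EFinD ltNyr.
  - by rewrite gt0_muley ?lte_fin.
have [||||p pB pmin] := lsc_min_compact [set x | `|x0 - x| <= r] F.
- exact: compact_cball.
- by exists x0; rewrite /= subrr normr0 /r; lra.
- exact: Fgt.
- move=> a; apply: closed_sublevel_add => // x.
  apply: cvgMl_tmp.
  have c : `|y - w| @[y --> x] --> `|x - w|.
    by apply: cvg_norm; apply: cvgB; [exact: cvg_id|exact: cvg_cst].
  exact: (cvgM c c).
have x0r : `|x0 - x0| <= r by rewrite subrr normr0 /r; lra.
exists p => x; have [/pmin//|xr] := leP `|x0 - x| r.
apply: le_trans (pmin x0 x0r) _.
rewrite /F fx0; case fx : (f x) => [s| |]; last 2 first.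
- by rewrite gt0_muley ?lte_fin// addye// leey.
- by have := fgt x; rewrite fx.
rewrite -!EFinM -!EFinD lee_fin -/D.
have := fK x; rewrite fx lee_fin => /(ler_wpM2l (ltW l0)) ls.
have dD : `|x0 - x| - D <= `|x - w|.
  rewrite lerBlDr [leLHS]distrC (_ : x - x0 = (x - w) - (x0 - w)); last first.
    by rewrite opprB addrA subrK.
  exact: ler_normB.
set d := `|x0 - x| in xr dD ls *.
have : (d - D) ^+ 2 <= `|x - w| ^+ 2.
  by rewrite ler_sqr ?nnegrE//; rewrite /r in xr; lra.
have {}ls : lambda * r0 - lambda * K * (1 + d) <= lambda * s.
  by apply: le_trans ls; rewrite mulrBr mulrA.
rewrite /r in xr; set L := lambda * K in lK0 xr ls.
have d1 : 1 <= d by lra.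
have Ld : 0 <= L * (d - 1) by rewrite mulr_ge0// subr_ge0.
have dd : 0 <= d * (d - (1 + 2 * D + 4 * L)).
  by rewrite mulr_ge0 ?subr_ge0 ?(ltW xr)// (le_trans ler01).
nra.
Qed.

End Prox.

(** * Strong convexity and strong monotonicity of subgradients *)

Section SubgradientSelection.
Context {R : realType} {V : finHilbertType R}.
Variables (h : V -> R) (s : V -> V).
Hypothesis subgradient : forall x y, h x + ⟨s x, y - x⟩ <= h y.

(** The sum of the subgradient inequalities from [x] to the midpoint [m] and
    from [m] to [y] has the slope [s m] on the second half, which exceeds
    [s x] by monotonicity. Finer subdivisions would improve [c / 4] to
    [c / 2]. *)
Lemma subgradient_strong (c : R) :
  (forall x y, c * `|x - y| ^+ 2 <= ⟨s x - s y, x - y⟩) ->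
  forall x y, h x + ⟨s x, y - x⟩ + c / 4 * `|y - x| ^+ 2 <= h y.
Proof.
move=> smono x y; pose m : V := x + 2^-1 *: (y - x).
have mx : m - x = 2^-1 *: (y - x) by rewrite /m addrC addKr.
have ym : y - m = 2^-1 *: (y - x).
  rewrite /m opprD addrA -{1}[y - x]scale1r -scalerBl; congr (_ *: _).
  by field.
have := smono m x; rewrite mx normrZ innerZr innerBl gtr0_norm ?invr_gt0//.
have := subgradient x m; have := subgradient m y.
rewrite mx ym !innerZr exprMn; lra.
Qed.

Lemma conv_combB (x y : V) (t : R) (m := t *: x + (1 - t) *: y) :
  x - m = (1 - t) *: (x - y) /\ y - m = - t *: (x - y).
Proof.
split; first by rewrite /m opprD addrA -{1}[x]scale1r -scalerBl scalerBr.
by rewrite /m scalerBl scale1r scaleNr opprD addrCA subKr scalerBr opprB addrC.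
Qed.

(** The average of the strengthened subgradient inequalities at
    [m = t x + (1 - t) y], taken towards [x] and [y] with weights [t] and
    [1 - t]: the linear terms cancel. *)
Lemma strongly_convex_of_monotone :
  strongly_monotone_on [set: V] s -> strongly_convex (fun x => (h x)%:E).
Proof.
move=> [c c0 smono].
have strong : forall x y, h x + ⟨s x, y - x⟩ + c / 4 * `|y - x| ^+ 2 <= h y.
  by apply: subgradient_strong => x y; exact: smono.
exists (c / 2); first by rewrite divr_gt0.
move=> x y t /andP[t0 t1]; rewrite -!EFinM -!EFinD lee_fin.
set m := t *: x + (1 - t) *: y.
have [xm ym] := conv_combB x y t; rewrite -/m in xm ym.
have := strong m x; have := strong m y; rewrite xm ym !innerZr !normrZ !exprMn.
rewrite !real_normK ?num_real// sqrrN.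
set i := ⟨_, _⟩; set q := `|x - y| ^+ 2 => sy sx.
have {}sx : t * (h m + (1 - t) * i + c / 4 * ((1 - t) ^+ 2 * q)) <= t * h x.
  by rewrite ler_wpM2l// ltW.
have {}sy : (1 - t) * (h m + - t * i + c / 4 * (t ^+ 2 * q)) <= (1 - t) * h y.
  by rewrite ler_wpM2l// subr_ge0 ltW.
apply: le_trans (lerB (lerD sx sy) (lexx _)).
lra.
Qed.

(** Strong convexity at the midpoint against the subgradient inequalities from
    [x] and from [y] to the midpoint. *)
Lemma strongly_monotone_of_convex :
  strongly_convex (fun x => (h x)%:E) -> strongly_monotone_on [set: V] s.
Proof.
move=> [mu mu0 hconv]; exists (mu / 2); first by rewrite divr_gt0.
move=> x y _ _; have t01 : 0 < (2^-1 : R) < 1 by lra.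
have := hconv x y _ t01; rewrite -!EFinM -!EFinD lee_fin.
set m := _ + _.
have [xm ym] := conv_combB x y 2^-1; rewrite -/m in xm ym.
have := subgradient x m; have := subgradient y m.
rewrite -(opprB x m) -(opprB y m) xm ym -!(scaleNr _ (x - y)) !innerZr innerBl.
lra.
Qed.

End SubgradientSelection.

(** * The dual objective *)

Section Dual.
Context {R : realType} {X Y : finHilbertType R}.
Variables (A : {linear X -> Y}) (b : Y) (f : X -> \bar R) (lambda : R) (z : X).
Hypotheses (lambda0 : 0 < lambda) (f_proper : proper_fun f)
  (f_closed : closed_fun f) (f_convex : convex_fun f).

Let p y := prox_shift f lambda z (adjoint A y).

Lemma prox_shift_argmin (u x : X) : let p := prox_shift f lambda z u in
  (lambda%:E * f p + (2^-1 * `|p - (z + u)| ^+ 2)%:E <=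
   lambda%:E * f x + (2^-1 * `|x - (z + u)| ^+ 2)%:E)%E.
Proof.
have ne := prox_objective_argmin f f_proper f_closed f_convex lambda (z + u).
exact: (xgetPex 0 (ne lambda0)).
Qed.

Lemma prox_shift_fin (u : X) : f (prox_shift f lambda z u) \is a fin_num.
Proof.
have [fgt [x0 fx0]] := f_proper; have := prox_shift_argmin u x0 => /=.
move: fx0 (fgt x0); rewrite /edom /=; case: (f x0) => [r0| |]// _ _.
have := fgt (prox_shift f lambda z u); case: (f _) => [r| |]// _.
by rewrite gt0_muley ?lte_fin.
Qed.

(** Completing the square; the last summand does not depend on [x]. *)
Lemma lagrangian_square (y : Y) (x : X) :
  2^-1 * `|x - z| ^+ 2 + ⟨y, b - A x⟩ =
  2^-1 * `|x - (z + adjoint A y)| ^+ 2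
    + (⟨y, b⟩ - ⟨adjoint A y, z⟩ - 2^-1 * `|adjoint A y| ^+ 2).
Proof.
set u := adjoint A y; rewrite (_ : x - (z + u) = x - z - u) ?opprD ?addrA//.
rewrite -!innerE !(innerBl, innerBr) -adjointP -/u.
rewrite (innerC z x) (innerC u x) (innerC u z); lra.
Qed.

(** The infimum defining the dual objective is attained at [p y], which makes
    this real number its value. *)
Definition dual_value (y : Y) : R :=
  - (lambda * fine (f (p y)) + 2^-1 * `|p y - z| ^+ 2 + ⟨y, b - A (p y)⟩).

Lemma lagrangian_le (y : Y) (x : X) : f x \is a fin_num ->
  - dual_value y <= lambda * fine (f x) + 2^-1 * `|x - z| ^+ 2 + ⟨y, b - A x⟩.
Proof.
move=> fx; rewrite /dual_value opprK -!addrA !lagrangian_square.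
have := prox_shift_argmin (adjoint A y) x; rewrite /= -/(p y).
rewrite -(fineK fx) -(fineK (prox_shift_fin (adjoint A y))) -/(p y).
rewrite -!EFinM -!EFinD lee_fin; lra.
Qed.

Lemma dual_objE : dual_obj A b f lambda z = fun y => (dual_value y)%:E.
Proof.
apply/funext => y; rewrite /dual_obj -[dual_value y]opprK EFinN; congr (- _)%E.
apply/eqP; rewrite eq_le; apply/andP; split.
  apply: ereal_inf_lbound; exists (p y) => //.
  rewrite -(fineK (prox_shift_fin (adjoint A y))) -/(p y).
  by rewrite -!EFinM -!EFinD /dual_value opprK.
apply/ereal_infP => _ [x _ <-]; have [fgt _] := f_proper.
have := fgt x; case fx : (f x) => [r| |]// _.
  have := @lagrangian_le y x; rewrite fx => /(_ isT) /=.
  by rewrite -!EFinM -!EFinD lee_fin.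
by rewrite gt0_muley ?lte_fin// !addye// leey.
Qed.

(** The Lagrangian of [y'] at the minimiser [p y] for [y] bounds the infimum for
    [y'] from above, and differs from that of [y] by [<y' - y, b - A (p y)>]. *)
Lemma dual_subgradient y y' :
  dual_value y + ⟨A (p y) - b, y' - y⟩ <= dual_value y'.
Proof.
have := @lagrangian_le y' _ (prox_shift_fin (adjoint A y)).
rewrite -/(p y) {2}/dual_value !innerBl !innerBr.
rewrite !(innerC _ y) !(innerC _ y'); lra.
Qed.

Lemma monotone_transfer : set_surj [set: X] [set: Y] A ->
  strongly_monotone_on (range (adjoint A)) (prox_shift f lambda z) <->
  strongly_monotone_on [set: Y] (fun y => A (p y) - b).
Proof.
move=> surjA.
have pairE y1 y2 : ⟨A (p y1) - b - (A (p y2) - b), y1 - y2⟩ =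
    ⟨p y1 - p y2, adjoint A y1 - adjoint A y2⟩.
  by rewrite opprB addrA subrK -linearB innerC -adjointP innerC adjointB.
split=> -[c c0 mono].
  have [M M0 AM] := adjoint_bounded_below A surjA.
  exists (c / M ^+ 2); first by rewrite divr_gt0// exprn_gt0.
  move=> y1 y2 _ _; rewrite pairE.
  apply: le_trans (mono _ _ _ _); [|by exists y1|by exists y2].
  rewrite -mulrA ler_wpM2l ?(ltW c0)// ler_pdivrMl ?exprn_gt0//.
  by rewrite adjointB -exprMn ler_sqr ?nnegrE// mulr_ge0// ltW.
have [M M0 AM] := adjoint_bounded A.
exists (c / M ^+ 2); first by rewrite divr_gt0// exprn_gt0.
move=> _ _ [y1 _ <-] [y2 _ <-]; rewrite -pairE.
apply: le_trans (mono _ _ _ _) => //.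
rewrite -mulrA ler_wpM2l ?(ltW c0)// ler_pdivrMl ?exprn_gt0//.
by rewrite adjointB -exprMn ler_sqr ?nnegrE// mulr_ge0// ltW.
Qed.

End Dual.

Theorem theorem3 (R : realType) (X Y : finHilbertType R) (lambda : R) (b : Y)
    (f : X -> \bar R) (A : {linear X -> Y}) (z : X) :
  0 < lambda ->
  proper_fun f -> closed_fun f -> convex_fun f ->
  set_surj [set: X] [set: Y] A ->
  (exists2 x : X, edom f x & A x = b) ->
  strongly_monotone_on (range (adjoint A)) (prox_shift f lambda z)
  <-> strongly_convex (dual_obj A b f lambda z).
Proof.
move=> lambda0 f_proper f_closed f_convex surjA _.
rewrite (@dual_objE _ _ _ A b f lambda z) //.
apply: iff_trans (@monotone_transfer _ _ _ A b f lambda z surjA) _.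
have subg := dual_subgradient A b f lambda z lambda0 f_proper f_closed f_convex.
split; first exact: strongly_convex_of_monotone subg.
exact: strongly_monotone_of_convex subg.
Qed.
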